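(* Up to equivalence (of $\Bbbk$-linear categories) there are exactly three preprojective categories $\Lambda_{\mathbb{I}}$ for $\mathbb{I}\subseteq\mathbb{R}$ a nonempty open interval, according to the following three mutually exclusive types of $\mathbb{I}$: (1) $\mathbb{I}$ is bounded, i.e. $\mathbb{I}=(a,b)$ with $a<b\in\mathbb{R}$; (2) $\mathbb{I}$ is bounded on exactly one side, i.e. $\mathbb{I}=(-\infty,b)$ or $\mathbb{I}=(a,+\infty)$ with $a,b\in\mathbb{R}$; (3) $\mathbb{I}=\mathbb{R}$. That is, for nonempty open intervals $\mathbb{I},\mathbb{J}$, the categories $\Lambda_{\mathbb{I}}$ and $\Lambda_{\mathbb{J}}$ are equivalent if and only if $\mathbb{I}$ and $\mathbb{J}$ are of the same type.
   Context: Let $\Bbbk$ be an algebraically closed field. $\Lambda_{\mathbb{R}}$ is the $\Bbbk$-linear category with objects the real numbers (plus a zero object) generated by morphisms $\alpha_{yx}:x\to y$ and $\alpha^*_{xy}:y\to x$ for $x<y$, with $\alpha_{xx}=\alpha^*_{xx}=1_x$, subject to: (1) $\alpha_{zy}\alpha_{yx}=\alpha_{zx}$ and $\alpha^*_{xy}\alpha^*_{yz}=\alpha^*_{xz}$ for $x\le y\le z$; (2) $\alpha^*_{x+a-b,x+a}\alpha_{x+a,x}=\alpha_{x+a-b,x-b}\alpha^*_{x-b,x}$ for $a,b>0$. For an interval $\mathbb{I}\subseteq\mathbb{R}$, the preprojective category $\Lambda_{\mathbb{I}}$ is the quotient category of $\Lambda_{\mathbb{R}}$ obtained by setting every object $x\notin\mathbb{I}$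 isomorphic to the zero object. *)

(* Defs.v *)
From HB Require Import structures.
From mathcomp Require Import all_boot all_order all_algebra.
From mathcomp Require Import mathcomp_extra boolp classical_sets set_interval.
From mathcomp Require Import reals topology normedtype.

Set Implicit Arguments.
Unset Strict Implicit.
Unset Printing Implicit Defensive.

Import Order.TTheory GRing.Theory Num.Theory.
Import numFieldNormedType.Exports.
Local Open Scope classical_set_scope.
Local Open Scope quotient_scope.
Local Open Scope ring_scope.

(* Composition is written in applicative order: [compm g f] is "g after f". *)
Record lincat (k : fieldType) := LinCat {
  ob :> Type;
  hom : ob -> ob -> lmodType k;
  idm : forall x, hom x x;
  compm : forall x y z, hom y z -> hom x y -> hom x z;
  compmA : forall x y z t (h : hom z t) (g : hom y z) (f : hom x y),
    compm h (compm g f) = compm (compm h g) f;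
  comp1m : forall x y (f : hom x y), compm (idm y) f = f;
  compm1 : forall x y (f : hom x y), compm f (idm x) = f;
  compm_linear_l : forall x y z (c : k) (g g' : hom y z) (f : hom x y),
    compm (c *: g + g') f = c *: compm g f + compm g' f;
  compm_linear_r : forall x y z (c : k) (g : hom y z) (f f' : hom x y),
    compm g (c *: f + f') = c *: compm g f + compm g f' }.

Arguments hom {k l} _ _.
Arguments idm {k l} _.
Arguments compm {k l x y z} _ _.

Record linfunctor (k : fieldType) (C D : lincat k) := LinFunctor {
  fob :> C -> D;
  fhom : forall x y, {linear @hom k C x y -> @hom k D (fob x) (fob y)};
  fhom_id : forall x, fhom x x (idm x) = idm (fob x);
  fhom_comp : forall x y z (g : hom y z) (f : hom x y),
    fhom x z (compm g f) = compm (fhom y z g) (fhom x y f) }.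

Arguments fhom {k C D} l {x y}.

(* [natiso_to_id F G]: the composite functor G o F is naturally isomorphic to
   the identity of C. *)
Definition natiso_to_id (k : fieldType) (C D : lincat k)
    (F : linfunctor C D) (G : linfunctor D C) : Prop :=
  exists (u : forall x : C, hom (G (F x)) x) (v : forall x : C, hom x (G (F x))),
    (forall x, compm (u x) (v x) = idm x /\ compm (v x) (u x) = idm (G (F x))) /\
    (forall x y (f : hom x y), compm (u y) (fhom G (fhom F f)) = compm f (u x)).

Definition lin_equivalent (k : fieldType) (C D : lincat k) : Prop :=
  exists (F : linfunctor C D) (G : linfunctor D C),
    natiso_to_id F G /\ natiso_to_id G F.

(* A type with operations satisfying the k-module axioms up to a congruence. *)
Record lmod_setoid (k : fieldType) := LmodSetoid {
  car :> Type;
  eqs : car -> car -> Prop;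
  zeros : car;
  adds : car -> car -> car;
  opps : car -> car;
  scales : k -> car -> car;
  eqs_refl : forall x, eqs x x;
  eqs_sym : forall x y, eqs x y -> eqs y x;
  eqs_trans : forall x y z, eqs x y -> eqs y z -> eqs x z;
  adds_eqs : forall x x' y y',
    eqs x x' -> eqs y y' -> eqs (adds x y) (adds x' y');
  opps_eqs : forall x x', eqs x x' -> eqs (opps x) (opps x');
  scales_eqs : forall c x x', eqs x x' -> eqs (scales c x) (scales c x');
  addsA : forall x y z, eqs (adds x (adds y z)) (adds (adds x y) z);
  addsC : forall x y, eqs (adds x y) (adds y x);
  add0s : forall x, eqs (adds zeros x) x;
  addNs : forall x, eqs (adds (opps x) x) zeros;
  scalesA : forall a b x, eqs (scales a (scales b x)) (scales (a * b) x);
  scale1s : forall x, eqs (scales 1 x) x;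
  scalesDr : forall a x y,
    eqs (scales a (adds x y)) (adds (scales a x) (scales a y));
  scalesDl : forall a b x,
    eqs (scales (a + b) x) (adds (scales a x) (scales b x)) }.

Arguments eqs {k l} _ _.

Section ModuleQuotient.
Variables (k : fieldType) (S : lmod_setoid k).

Definition eqsb : rel {classic S} := fun x y => `[< eqs (x : S) (y : S) >].

Lemma eqsb_equiv : equiv_class_of eqsb.
Proof.
split.
- by move=> x; apply/asboolP/eqs_refl.
- move=> x y; apply/idP/idP => /asboolP h; apply/asboolP; exact: eqs_sym.
- move=> y x z /asboolP h /asboolP h'; apply/asboolP; exact: eqs_trans h h'.
Qed.

Canonical eqsb_equiv_rel := EquivRelPack eqsb_equiv.

Definition lmod_quot := {eq_quot eqsb_equiv_rel}.
HB.instance Definition _ := Choice.on lmod_quot.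

Definition cls (x : S) : lmod_quot := \pi_lmod_quot (x : {classic S}).
Definition rep (X : lmod_quot) : S := repr X.

Lemma repK X : cls (rep X) = X.
Proof. exact: reprK. Qed.

Lemma clsP (x y : S) : cls x = cls y <-> eqs x y.
Proof.
split=> [/eqquotP /asboolP //|h].
by apply/eqquotP/asboolP.
Qed.

Lemma rep_cls (x : S) : eqs (rep (cls x)) x.
Proof. by apply/clsP; rewrite repK. Qed.

Definition lq_zero : lmod_quot := cls (zeros S).
Definition lq_add (X Y : lmod_quot) : lmod_quot := cls (adds (rep X) (rep Y)).
Definition lq_opp (X : lmod_quot) : lmod_quot := cls (opps (rep X)).
Definition lq_scale (c : k) (X : lmod_quot) : lmod_quot :=
  cls (scales c (rep X)).

Lemma lq_addE x y : lq_add (cls x) (cls y) = cls (adds x y).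
Proof. by apply/clsP/adds_eqs; exact: rep_cls. Qed.

Lemma lq_oppE x : lq_opp (cls x) = cls (opps x).
Proof. by apply/clsP/opps_eqs; exact: rep_cls. Qed.

Lemma lq_scaleE c x : lq_scale c (cls x) = cls (scales c x).
Proof. by apply/clsP/scales_eqs; exact: rep_cls. Qed.

Lemma lq_addA : associative lq_add.
Proof.
move=> X Y Z; rewrite -(repK X) -(repK Y) -(repK Z) !lq_addE.
by apply/clsP/addsA.
Qed.

Lemma lq_addC : commutative lq_add.
Proof. by move=> X Y; rewrite -(repK X) -(repK Y) !lq_addE; apply/clsP/addsC. Qed.

Lemma lq_add0 : left_id lq_zero lq_add.
Proof. by move=> X; rewrite -(repK X) lq_addE; apply/clsP/add0s. Qed.

Lemma lq_addN : left_inverse lq_zero lq_opp lq_add.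
Proof. by move=> X; rewrite -(repK X) lq_oppE lq_addE; apply/clsP/addNs. Qed.

HB.instance Definition _ :=
  GRing.isZmodule.Build lmod_quot lq_addA lq_addC lq_add0 lq_addN.

Lemma lq_scaleA a b X : lq_scale a (lq_scale b X) = lq_scale (a * b) X.
Proof. by rewrite -(repK X) !lq_scaleE; apply/clsP/scalesA. Qed.

Lemma lq_scale1 : left_id 1 lq_scale.
Proof. by move=> X; rewrite -(repK X) lq_scaleE; apply/clsP/scale1s. Qed.

Lemma lq_scaleDr : right_distributive lq_scale +%R.
Proof.
move=> a X Y; rewrite -(repK X) -(repK Y).
by rewrite [LHS](congr1 _ (lq_addE _ _)) !lq_scaleE [RHS]lq_addE; apply/clsP/scalesDr.
Qed.

Lemma lq_scaleDl X : {morph lq_scale^~ X : a b / a + b}.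
Proof.
move=> a b; rewrite -(repK X) !lq_scaleE [RHS]lq_addE.
by apply/clsP/scalesDl.
Qed.

HB.instance Definition _ := GRing.Zmodule_isLmodule.Build k lmod_quot
  lq_scaleA lq_scale1 lq_scaleDr lq_scaleDl.

Lemma cls0 : cls (zeros S) = 0. Proof. by []. Qed.

Lemma clsD x y : cls (adds x y) = cls x + cls y.
Proof. by rewrite -lq_addE. Qed.

Lemma clsN x : cls (opps x) = - cls x.
Proof. by rewrite -lq_oppE. Qed.

Lemma clsZ c x : cls (scales c x) = c *: cls x.
Proof. by rewrite -lq_scaleE. Qed.

End ModuleQuotient.

Record prelincat (k : fieldType) := PreLinCat {
  pob : Type;
  phom : pob -> pob -> lmod_setoid k;
  pid : forall x, phom x x;
  pcomp : forall x y z, phom y z -> phom x y -> phom x z;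
  pcomp_eqs : forall x y z (g g' : phom y z) (f f' : phom x y),
    eqs g g' -> eqs f f' -> eqs (pcomp g f) (pcomp g' f');
  pcompA : forall x y z t (h : phom z t) (g : phom y z) (f : phom x y),
    eqs (pcomp h (pcomp g f)) (pcomp (pcomp h g) f);
  pcomp1m : forall x y (f : phom x y), eqs (pcomp (pid y) f) f;
  pcompm1 : forall x y (f : phom x y), eqs (pcomp f (pid x)) f;
  pcomp_linear_l : forall x y z (c : k) (g g' : phom y z) (f : phom x y),
    eqs (pcomp (adds (scales c g) g') f)
        (adds (scales c (pcomp g f)) (pcomp g' f));
  pcomp_linear_r : forall x y z (c : k) (g : phom y z) (f f' : phom x y),
    eqs (pcomp g (adds (scales c f) f'))
        (adds (scales c (pcomp g f)) (pcomp g f')) }.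

Arguments pcomp {k p x y z} _ _.

Section CategoryQuotient.
Variables (k : fieldType) (P : prelincat k).

Definition qhom (x y : pob P) : lmodType k := lmod_quot (phom x y).

Definition qid (x : pob P) : qhom x x := cls (pid x).

Definition qcomp (x y z : pob P) (G : qhom y z) (F : qhom x y) : qhom x z :=
  cls (pcomp (rep G) (rep F)).

Lemma qcompE x y z (g : phom y z) (f : phom x y) :
  qcomp (cls g) (cls f) = cls (pcomp g f).
Proof. by apply/clsP/pcomp_eqs; exact: rep_cls. Qed.

Lemma qcompA x y z t (h : qhom z t) (g : qhom y z) (f : qhom x y) :
  qcomp h (qcomp g f) = qcomp (qcomp h g) f.
Proof.
rewrite -(repK h) -(repK g) -(repK f) !qcompE.
by apply/clsP/pcompA.
Qed.

Lemma qcomp1m x y (f : qhom x y) : qcomp (qid y) f = f.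
Proof. by rewrite -[in RHS](repK f) -(repK f) qcompE repK; apply/clsP/pcomp1m. Qed.

Lemma qcompm1 x y (f : qhom x y) : qcomp f (qid x) = f.
Proof. by rewrite -[in RHS](repK f) -(repK f) qcompE repK; apply/clsP/pcompm1. Qed.

Lemma qcomp_linear_l x y z (c : k) (g g' : qhom y z) (f : qhom x y) :
  qcomp (c *: g + g') f = c *: qcomp g f + qcomp g' f.
Proof.
rewrite -(repK g) -(repK g') -(repK f) -clsZ -clsD !qcompE -clsZ -clsD.
by apply/clsP/pcomp_linear_l.
Qed.

Lemma qcomp_linear_r x y z (c : k) (g : qhom y z) (f f' : qhom x y) :
  qcomp g (c *: f + f') = c *: qcomp g f + qcomp g f'.
Proof.
rewrite -(repK g) -(repK f) -(repK f') -clsZ -clsD !qcompE -clsZ -clsD.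
by apply/clsP/pcomp_linear_r.
Qed.

Definition quotcat : lincat k :=
  LinCat qcompA qcomp1m qcompm1 qcomp_linear_l qcomp_linear_r.

End CategoryQuotient.

(* Formal k-linear combinations of formal composites of generating arrows. *)
Inductive term (k : fieldType) (V : Type) (A : V -> V -> Type) :
    V -> V -> Type :=
| tgen x y : A x y -> term k A x y
| tid x : term k A x x
| tcomp x y z : term k A y z -> term k A x y -> term k A x z
| tzero x y : term k A x y
| tadd x y : term k A x y -> term k A x y -> term k A x y
| topp x y : term k A x y -> term k A x y
| tscale x y : k -> term k A x y -> term k A x y.

Arguments tgen {k V A x y} _.
Arguments tid {k V A} _.
Arguments tcomp {k V A x y z} _ _.
Arguments tzero {k V A} _ _.

(* The least congruence containing [E] and the axioms of k-linear categories. *)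
Inductive teq (k : fieldType) (V : Type) (A : V -> V -> Type)
    (E : forall x y, term k A x y -> term k A x y -> Prop) :
    forall x y, term k A x y -> term k A x y -> Prop :=
| teq_rel x y (s t : term k A x y) : E x y s t -> teq E s t
| teq_refl x y (s : term k A x y) : teq E s s
| teq_sym x y (s t : term k A x y) : teq E s t -> teq E t s
| teq_trans x y (s t u : term k A x y) : teq E s t -> teq E t u -> teq E s u
| teq_comp x y z (g g' : term k A y z) (f f' : term k A x y) :
    teq E g g' -> teq E f f' -> teq E (tcomp g f) (tcomp g' f')
| teq_add x y (s s' t t' : term k A x y) :
    teq E s s' -> teq E t t' -> teq E (tadd s t) (tadd s' t')
| teq_opp x y (s s' : term k A x y) : teq E s s' -> teq E (topp s) (topp s')
| teq_scale x y c (s s' : term k A x y) :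
    teq E s s' -> teq E (tscale c s) (tscale c s')
| teq_addA x y (s t u : term k A x y) :
    teq E (tadd s (tadd t u)) (tadd (tadd s t) u)
| teq_addC x y (s t : term k A x y) : teq E (tadd s t) (tadd t s)
| teq_add0 x y (s : term k A x y) : teq E (tadd (tzero x y) s) s
| teq_addN x y (s : term k A x y) : teq E (tadd (topp s) s) (tzero x y)
| teq_scaleA x y a b (s : term k A x y) :
    teq E (tscale a (tscale b s)) (tscale (a * b) s)
| teq_scale1 x y (s : term k A x y) : teq E (tscale 1 s) s
| teq_scaleDr x y a (s t : term k A x y) :
    teq E (tscale a (tadd s t)) (tadd (tscale a s) (tscale a t))
| teq_scaleDl x y a b (s : term k A x y) :
    teq E (tscale (a + b) s) (tadd (tscale a s) (tscale b s))
| teq_compA x y z t (h : term k A z t) (g : term k A y z) (f : term k A x y) :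
    teq E (tcomp h (tcomp g f)) (tcomp (tcomp h g) f)
| teq_comp1m x y (f : term k A x y) : teq E (tcomp (tid y) f) f
| teq_compm1 x y (f : term k A x y) : teq E (tcomp f (tid x)) f
| teq_linear_l x y z c (g g' : term k A y z) (f : term k A x y) :
    teq E (tcomp (tadd (tscale c g) g') f)
          (tadd (tscale c (tcomp g f)) (tcomp g' f))
| teq_linear_r x y z c (g : term k A y z) (f f' : term k A x y) :
    teq E (tcomp g (tadd (tscale c f) f'))
          (tadd (tscale c (tcomp g f)) (tcomp g f')).

Section Presentation.
Variables (k : fieldType) (V : Type) (A : V -> V -> Type).
Variable E : forall x y, term k A x y -> term k A x y -> Prop.

Definition term_setoid (x y : V) : lmod_setoid k := LmodSetoid
  (@teq_refl k V A E x y) (@teq_sym k V A E x y) (@teq_trans k V A E x y)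
  (@teq_add k V A E x y) (@teq_opp k V A E x y) (@teq_scale k V A E x y)
  (@teq_addA k V A E x y) (@teq_addC k V A E x y) (@teq_add0 k V A E x y)
  (@teq_addN k V A E x y) (@teq_scaleA k V A E x y) (@teq_scale1 k V A E x y)
  (@teq_scaleDr k V A E x y) (@teq_scaleDl k V A E x y).

Definition term_precat : prelincat k :=
  @PreLinCat k V term_setoid (@tid k V A) (@tcomp k V A)
    (@teq_comp k V A E) (@teq_compA k V A E) (@teq_comp1m k V A E)
    (@teq_compm1 k V A E) (@teq_linear_l k V A E) (@teq_linear_r k V A E).

Definition presented : lincat k := quotcat term_precat.

End Presentation.

(* The two-sided ideal generated by a family [S] of morphisms. *)
Inductive ideal (k : fieldType) (C : lincat k)
    (S : forall x y : C, hom x y -> Prop) : forall x y : C, hom x y -> Prop :=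
| ideal_gen x y (f : hom x y) : S x y f -> ideal S f
| ideal_zero x y : ideal S (0 : hom x y)
| ideal_linear x y (c : k) (f g : hom x y) :
    ideal S f -> ideal S g -> ideal S (c *: f + g)
| ideal_compl x y z (g : hom y z) (f : hom x y) :
    ideal S f -> ideal S (compm g f)
| ideal_compr x y z (g : hom y z) (f : hom x y) :
    ideal S g -> ideal S (compm g f).

Section IdealQuotient.
Variables (k : fieldType) (C : lincat k).
Variable S : forall x y : C, hom x y -> Prop.
Arguments S {x y} _.

Definition ieq (x y : C) (f g : hom x y) : Prop := ideal (@S) (f - g).

Lemma idealZ x y c (f : @hom k C x y) : ideal (@S) f -> ideal (@S) (c *: f).
Proof.
by move=> h; rewrite -[_ *: _]addr0; apply: ideal_linear h _; exact: ideal_zero.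
Qed.

Lemma idealD x y (f g : @hom k C x y) :
  ideal (@S) f -> ideal (@S) g -> ideal (@S) (f + g).
Proof. by move=> hf hg; rewrite -[f]scale1r; exact: ideal_linear. Qed.

Lemma ieq_eq x y (f g : @hom k C x y) : f = g -> ieq f g.
Proof. by move=> ->; rewrite /ieq subrr; exact: ideal_zero. Qed.

Lemma ieq_refl x y (f : @hom k C x y) : ieq f f.
Proof. exact: ieq_eq. Qed.

Lemma ieq_sym x y (f g : @hom k C x y) : ieq f g -> ieq g f.
Proof. by move=> h; rewrite /ieq -opprB -scaleN1r; exact: idealZ. Qed.

Lemma ieq_trans x y (f g h : @hom k C x y) : ieq f g -> ieq g h -> ieq f h.
Proof.
by move=> hfg hgh; rewrite /ieq -(subrKA g); exact: idealD.
Qed.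

Lemma ieq_add x y (f f' g g' : @hom k C x y) :
  ieq f f' -> ieq g g' -> ieq (f + g) (f' + g').
Proof. by move=> hf hg; rewrite /ieq opprD addrACA; exact: idealD. Qed.

Lemma ieq_opp x y (f f' : @hom k C x y) : ieq f f' -> ieq (- f) (- f').
Proof. by move=> h; rewrite /ieq -opprD -[X in ideal _ X]scaleN1r; exact: idealZ. Qed.

Lemma ieq_scale x y c (f f' : @hom k C x y) :
  ieq f f' -> ieq (c *: f) (c *: f').
Proof. by move=> h; rewrite /ieq -scalerBr; exact: idealZ. Qed.

Definition ideal_setoid (x y : C) : lmod_setoid k :=
  @LmodSetoid k (@hom k C x y) (@ieq x y) 0 +%R -%R *:%R
    (@ieq_refl x y) (@ieq_sym x y) (@ieq_trans x y)
    (@ieq_add x y) (@ieq_opp x y) (@ieq_scale x y)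
    (fun f g h => ieq_eq (addrA f g h)) (fun f g => ieq_eq (addrC f g))
    (fun f => ieq_eq (add0r f)) (fun f => ieq_eq (addNr f))
    (fun a b f => ieq_eq (scalerA a b f)) (fun f => ieq_eq (scale1r f))
    (fun a f g => ieq_eq (scalerDr a f g))
    (fun a b f => ieq_eq (scalerDl f a b)).

Lemma ieq_comp (x y z : C) (g g' : hom y z) (f f' : hom x y) :
  ieq g g' -> ieq f f' -> ieq (compm g f) (compm g' f').
Proof.
move=> hg hf; apply: (@ieq_trans _ _ _ (compm g' f)); rewrite /ieq.
  have -> : compm g f - compm g' f = compm (g - g') f.
    rewrite -[g - g']addrC -[- g']scaleN1r compm_linear_l.
    by rewrite scaleN1r addrC.
  exact: ideal_compr.
have -> : compm g' f - compm g' f' = compm g' (f - f').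
  rewrite -[f - f']addrC -[- f']scaleN1r compm_linear_r.
  by rewrite scaleN1r addrC.
exact: ideal_compl.
Qed.

Definition ideal_precat : prelincat k :=
  @PreLinCat k C ideal_setoid (@idm k C) (@compm k C) ieq_comp
    (fun x y z t h g f => ieq_eq (compmA h g f))
    (fun x y f => ieq_eq (comp1m f)) (fun x y f => ieq_eq (compm1 f))
    (fun x y z c g g' f => ieq_eq (compm_linear_l c g g' f))
    (fun x y z c g f f' => ieq_eq (compm_linear_r c g f f')).

Definition ideal_quotient : lincat k := quotcat ideal_precat.

End IdealQuotient.

Section Preprojective.
Variables (k : fieldType) (R : realType).

(* Objects: [Some x] is the real number x, [None] is the zero object.
   [alpha] x y : x -> y and [alphas] x y : y -> x are included for x = y too,
   and then identified with 1_x by [alpha_id] and [alphas_id] below. *)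
Inductive arrow : option R -> option R -> Type :=
| alpha (x y : R) : x <= y -> arrow (Some x) (Some y)
| alphas (x y : R) : x <= y -> arrow (Some y) (Some x).

Inductive preproj_rel :
    forall x y : option R, term k arrow x y -> term k arrow x y -> Prop :=
| zero_object : preproj_rel (tid None) (tzero None None)
| alpha_id (x : R) (xx : x <= x) :
    preproj_rel (tgen (alpha xx)) (tid (Some x))
| alphas_id (x : R) (xx : x <= x) :
    preproj_rel (tgen (alphas xx)) (tid (Some x))
| alpha_comp (x y z : R) (xy : x <= y) (yz : y <= z) (xz : x <= z) :
    preproj_rel (tcomp (tgen (alpha yz)) (tgen (alpha xy))) (tgen (alpha xz))
| alphas_comp (x y z : R) (xy : x <= y) (yz : y <= z) (xz : x <= z) :
    preproj_rel (tcomp (tgen (alphas xy)) (tgen (alphas yz)))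
                (tgen (alphas xz))
| alpha_alphas (x a b : R) (a_gt0 : 0 < a) (b_gt0 : 0 < b)
    (up : x <= x + a) (down : x + a - b <= x + a)
    (down' : x - b <= x) (up' : x - b <= x + a - b) :
    preproj_rel (tcomp (tgen (alphas down)) (tgen (alpha up)))
                (tcomp (tgen (alpha up')) (tgen (alphas down'))).

Definition LambdaR : lincat k := presented preproj_rel.

(* An object is isomorphic to the zero object iff its identity vanishes, so
   the objects x outside I are killed by the ideal generated by their 1_x. *)
Inductive outside_id (I : set R) : forall x y : LambdaR, hom x y -> Prop :=
| OutsideId (x : R) : ~ I x -> outside_id I (@idm k LambdaR (Some x)).

Definition Lambda (I : set R) : lincat k := ideal_quotient (@outside_id I).

End Preprojective.

Section Intervals.
Variable R : realType.

Definition nonempty_open_interval (I : set R) : Prop :=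
  [/\ I !=set0, open I & is_interval I].

Inductive interval_type := BothSides | OneSide | NoSide.

Definition has_type (I : set R) (t : interval_type) : Prop :=
  match t with
  | BothSides => exists a b : R, a < b /\ I = [set` `]a, b[ ]
  | OneSide => (exists b : R, I = [set` `]-oo, b[ ]) \/
               (exists a : R, I = [set` `]a, +oo[ ])
  | NoSide => I = setT
  end.

End Intervals.

(* Main.v *)
From HB Require Import structures.
From mathcomp Require Import all_boot all_order all_algebra.
From mathcomp Require Import boolp classical_sets set_interval reals topology normedtype.
From mathcomp Require Import ring lra.
Require Import Defs.

(** Write a morphism of the category on the whole line as a linear combination
    of journeys.  A journey from x to y that moves down by d in total must move
    up by y - x + d in total, and the commuting squares let its steps be
    reordered, so that it depends on x, y and d alone: [nf x y d] goes down from
    x to x - d and then up to y.  Journeys compose by adding their descents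
    ([nf_comp]), hence they span ([hom_nf_coef]).  They are also independent,
    because the upward arrows may act on functions R -> k by the identity and
    the downward ones by translation, and distinct translations are linearly
    independent; this action gives the coordinates [coef].

    Killing the objects outside an interval I kills exactly the journeys that
    can be rerouted through the complement of I.  The journey [nf x y d] has the
    lowest stop x - d and, reordered, the highest stop y + d, so a morphism dies
    if and only if it has no coordinate at any d with x - d and y + d both in I
    ([ideal_coef], [coef_ideal]).

    Each type of interval forms a single class: an invertible affine map of the
    line permutes the direct paths, either keeping or exchanging the two
    directions, and preserves all relations ([affine_equivalent]).  Affine maps
    act transitively on bounded open intervals and on open rays.

    To separate the types, consider on nonzero objects the relation that a
    monomorphism x -> y exists ([embeds]); its symmetry and its totality are
    invariant under equivalence.
    - If x < y and b is the upper end of I, let w be a point of I, at or above x,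
      with w + (y - x) at or beyond b.  Descending from w to x is nonzero, but
      every morphism x -> y climbs by at least y - x, so it kills this descent:
      no morphism x -> y is mono.  Likewise, when I has a lower end and y < x,
      no morphism x -> y is mono.
    - If I has no lower end, the descent from x to y is mono, as it lowers the
      lowest stop of a journey and fixes the highest one.  Likewise the ascents
      are mono when I has no upper end.
    So the relation is equality for a bounded interval (symmetric, not total),
    the order or its opposite for a ray (not symmetric), and total for the whole
    line. *)

Set Implicit Arguments.
Unset Strict Implicit.
Unset Printing Implicit Defensive.

Import Order.TTheory GRing.Theory Num.Theory.
Import numFieldNormedType.Exports.
Local Open Scope classical_set_scope.
Local Open Scope ring_scope.

(** * Monomorphisms in linear categories *)

Section LinearCategory.
Variables (k : fieldType) (C : lincat k).
Implicit Types x y z : C.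

Lemma compm0 x y z (g : hom y z) : compm g (0 : hom x y) = 0.
Proof.
have := compm_linear_r 1 g (0 : hom x y) 0.
by rewrite !scale1r addr0 -[X in X = _ -> _]addr0 => /addrI <-.
Qed.

Lemma comp0m x y z (f : hom x y) : compm (0 : hom y z) f = 0.
Proof.
have := compm_linear_l 1 (0 : hom y z) 0 f.
by rewrite !scale1r addr0 -[X in X = _ -> _]addr0 => /addrI <-.
Qed.

Lemma compmZl x y z c (g : hom y z) (f : hom x y) :
  compm (c *: g) f = c *: compm g f.
Proof. by rewrite -[c *: g]addr0 compm_linear_l comp0m addr0. Qed.

Lemma compmZr x y z c (g : hom y z) (f : hom x y) :
  compm g (c *: f) = c *: compm g f.
Proof. by rewrite -[c *: f]addr0 compm_linear_r compm0 addr0. Qed.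

Lemma compm_suml x y z (T : Type) (s : seq T) (g : T -> hom y z) (f : hom x y) :
  compm (\sum_(i <- s) g i) f = \sum_(i <- s) compm (g i) f.
Proof.
elim: s => [|i s IH]; first by rewrite !big_nil comp0m.
by rewrite !big_cons -[g i in LHS]scale1r compm_linear_l IH scale1r.
Qed.

Lemma compm_sumr x y z (T : Type) (s : seq T) (g : hom y z) (f : T -> hom x y) :
  compm g (\sum_(i <- s) f i) = \sum_(i <- s) compm g (f i).
Proof.
elim: s => [|i s IH]; first by rewrite !big_nil compm0.
by rewrite !big_cons -[f i in LHS]scale1r compm_linear_r IH scale1r.
Qed.

Definition mono x y (f : hom x y) : Prop :=
  forall z (h : hom z x), compm f h = 0 -> h = 0.

(** Zero objects are excluded: every morphism out of one is mono, which would
    destroy symmetry in all cases. *)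
Definition embeds x y : Prop :=
  [/\ idm x <> 0, idm y <> 0 & exists f : hom x y, mono f].

Lemma hom_from_zero x y (f : hom x y) : idm x = 0 -> f = 0.
Proof. by move=> x0; rewrite -(compm1 f) x0 compm0. Qed.

End LinearCategory.

(** * Invariance under equivalence *)

Section EquivalenceInvariance.
Variable k : fieldType.

Lemma natiso_faithful (C D : lincat k) (F : linfunctor C D) (G : linfunctor D C)
    x y (f : @hom k C x y) :
  natiso_to_id F G -> fhom F f = 0 -> f = 0.
Proof.
move=> [u [v [uv nat]]] Ff0; have [uvx _] := uv x.
by rewrite -(compm1 f) -uvx compmA -nat Ff0 linear0 compm0 comp0m.
Qed.

(** Naturality forces the only candidate, G h conjugated by the isomorphisms
    G (F x) = x and G (F y) = y; that F maps it to h is checked after applying G,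
    which is faithful as well. *)
Lemma natiso_full (C D : lincat k) (F : linfunctor C D) (G : linfunctor D C)
    x y (h : @hom k D (F x) (F y)) :
  natiso_to_id F G -> natiso_to_id G F -> exists f : hom x y, fhom F f = h.
Proof.
move=> FG GF; have [u [v [uv nat]]] := FG.
exists (compm (u y) (compm (fhom G h) (v x))).
set f := compm _ _; suff GFf : fhom G (fhom F f) = fhom G h.
  apply: subr0_eq; apply: (natiso_faithful GF).
  by rewrite linearB GFf subrr.
have [_ vuy] := uv y; have [_ vux] := uv x.
rewrite -[LHS]comp1m -vuy -compmA nat /f -!compmA vux compm1.
by rewrite compmA vuy comp1m.
Qed.

(** Fullness and faithfulness handle test morphisms out of objects F c; an
    arbitrary object d of D is isomorphic to F (G d). *)
Lemma mono_fhom (C D : lincat k) (F : linfunctor C D) (G : linfunctor D C)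
    x y (f : @hom k C x y) :
  natiso_to_id F G -> natiso_to_id G F -> mono f -> mono (fhom F f).
Proof.
move=> FG GF mf d h fh0; have [u [v [uv nat]]] := GF.
have [g Fg] := natiso_full (compm h (u d)) FG GF.
have g0 : g = 0.
  apply: mf; apply: (natiso_faithful FG).
  by rewrite fhom_comp Fg compmA fh0 comp0m.
have [uvd _] := uv d.
by rewrite -(compm1 h) -uvd compmA -Fg g0 linear0 comp0m.
Qed.

Lemma mono_comp_iso (C : lincat k) (x x' y y' : C) (f : hom x y)
    (a : hom x' x) (a' : hom x x') (b : hom y y') (b' : hom y' y) :
  compm a' a = idm x' -> compm b' b = idm y ->
  mono f -> mono (compm b (compm f a)).
Proof.
move=> a'a b'b mf z h bfah0.
have ah0 : compm a h = 0.
  apply: mf; rewrite -[LHS]comp1m -b'b -compmA.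
  by move: bfah0; rewrite -!compmA => ->; rewrite compm0.
by rewrite -(comp1m h) -a'a -compmA ah0 compm0.
Qed.

Lemma embeds_fhom (C D : lincat k) (F : linfunctor C D) (G : linfunctor D C) x y :
  natiso_to_id F G -> natiso_to_id G F -> embeds (F x) (F y) <-> embeds x y.
Proof.
move=> FG GF.
have nz z : idm (F z) <> 0 <-> idm z <> 0.
  split=> nz0 z0; apply: nz0; first by rewrite -fhom_id z0 linear0.
  by apply: (natiso_faithful FG); rewrite fhom_id.
split=> -[/nz nx /nz ny [f mf]]; split=> //;
  [|by exists (fhom F f); apply: (mono_fhom FG GF)].
have [u [v [uv nat]]] := FG.
have uvx := uv x; have uvy := uv y.
exists (compm (u y) (compm (fhom G f) (v x))).
exact: mono_comp_iso uvx.1 uvy.2 (mono_fhom GF FG mf).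
Qed.

Definition embeds_sym (C : lincat k) := forall x y : C, embeds x y -> embeds y x.
Definition embeds_full (C : lincat k) :=
  forall x y : C, idm x <> 0 -> idm y <> 0 -> embeds x y.

Lemma equivalent_sym (C D : lincat k) : lin_equivalent C D -> lin_equivalent D C.
Proof. by move=> [F [G [FG GF]]]; exists G, F. Qed.

Lemma equivalent_embeds_sym (C D : lincat k) :
  lin_equivalent C D -> embeds_sym C -> embeds_sym D.
Proof.
move=> [F [G [FG GF]]] sC x y /(embeds_fhom _ _ GF FG) xy.
by apply/(embeds_fhom _ _ GF FG)/sC.
Qed.

Lemma equivalent_embeds_full (C D : lincat k) :
  lin_equivalent C D -> embeds_full C -> embeds_full D.
Proof.
move=> [F [G [FG GF]]] fC x y x0 y0; apply/(embeds_fhom _ _ GF FG)/fC.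
  by move=> z; apply: x0; apply: (natiso_faithful GF); rewrite fhom_id.
by move=> z; apply: y0; apply: (natiso_faithful GF); rewrite fhom_id.
Qed.

End EquivalenceInvariance.

(** * Universal properties of presented and quotient categories *)

Section PresentedLift.
Variables (k : fieldType) (V : Type) (A : V -> V -> Type).
Variable E : forall x y, term k A x y -> term k A x y -> Prop.
Arguments E {x y} _ _.

Definition pcls x y (t : term k A x y) : @hom k (presented (@E)) x y :=
  @cls k (term_setoid (@E) x y) t.

Lemma pcls_comp x y z (g : term k A y z) (f : term k A x y) :
  compm (pcls g) (pcls f) = pcls (tcomp g f).
Proof. exact: (@qcompE k (term_precat (@E))). Qed.

Lemma pcls_rel x y (s t : term k A x y) : E s t -> pcls s = pcls t.
Proof. by move=> Est; apply/clsP/teq_rel. Qed.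

Lemma pcls_surj x y (f : @hom k (presented (@E)) x y) : exists t, f = pcls t.
Proof. by exists (rep f); rewrite /pcls repK. Qed.

Lemma pcls_linear x y c (s t : term k A x y) :
  pcls (tadd (tscale c s) t) = c *: pcls s + pcls t.
Proof. by rewrite /pcls -clsZ -clsD. Qed.

Lemma presented_ind
    (Q : forall x y, @hom k (presented (@E)) x y -> Prop) :
  (forall x y (a : A x y), Q x y (pcls (tgen a))) ->
  (forall x : presented (@E), Q x x (idm x)) ->
  (forall (x y z : presented (@E)) (g : hom y z) (f : hom x y),
     Q y z g -> Q x y f -> Q x z (compm g f)) ->
  (forall x y, Q x y 0) ->
  (forall (x y : presented (@E)) c (f g : hom x y),
     Q x y f -> Q x y g -> Q x y (c *: f + g)) ->
  forall x y f, Q x y f.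
Proof.
move=> Qgen Qid Qcomp Q0 Qlin x y f; have [t ->] := pcls_surj f.
have QZ x' y' c g : Q x' y' g -> Q x' y' (c *: g).
  by move=> Qg; rewrite -[c *: g]addr0; exact: Qlin.
elim: t => {x y f} [x y a|x|x y z g Qg f Qf|x y|x y f Qf g Qg|x y f Qf|x y c f Qf].
- exact: Qgen.
- exact: Qid.
- by rewrite -pcls_comp; exact: Qcomp.
- exact: Q0.
- have -> : pcls (tadd f g) = 1 *: pcls f + pcls g by rewrite scale1r -clsD.
  exact: Qlin.
- have -> : pcls (topp f) = -1 *: pcls f by rewrite scaleN1r -clsN.
  exact: QZ.
- have -> : pcls (tscale c f) = c *: pcls f by rewrite -clsZ.
  exact: QZ.
Qed.

Variables (D : lincat k) (o : V -> D) (h : forall x y, A x y -> hom (o x) (o y)).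

Fixpoint eval x y (t : term k A x y) : hom (o x) (o y) :=
  match t with
  | tgen _ _ a => h a
  | tid x => idm (o x)
  | tcomp _ _ _ g f => compm (eval g) (eval f)
  | tzero _ _ => 0
  | tadd _ _ s t => eval s + eval t
  | topp _ _ s => - eval s
  | tscale _ _ c s => c *: eval s
  end.

Hypothesis evalE : forall x y (s t : term k A x y), E s t -> eval s = eval t.

Lemma eval_teq x y (s t : term k A x y) : teq (@E) s t -> eval s = eval t.
Proof.
elim=> {x y s t} //=; try by move=> *; congruence.
- by move=> *; rewrite addrA.
- by move=> *; rewrite addrC.
- by move=> *; rewrite add0r.
- by move=> *; rewrite addNr.
- by move=> *; rewrite scalerA.
- by move=> *; rewrite scale1r.
- by move=> *; rewrite scalerDr.
- by move=> *; rewrite scalerDl.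
- by move=> *; rewrite compmA.
- by move=> *; rewrite comp1m.
- by move=> *; rewrite compm1.
- by move=> *; rewrite compm_linear_l.
- by move=> *; rewrite compm_linear_r.
Qed.

(** The value does not depend on the representative, by [eval_teq]. *)
Definition lift_fun x y (f : @hom k (presented (@E)) x y) : hom (o x) (o y) :=
  eval (rep f).

Lemma lift_fun_pcls x y (t : term k A x y) : lift_fun (pcls t) = eval t.
Proof. by apply: eval_teq; exact: (rep_cls (t : term_setoid (@E) x y)). Qed.

Lemma lift_fun_linear x y : linear (@lift_fun x y).
Proof.
move=> c f g; have [s ->] := pcls_surj f; have [t ->] := pcls_surj g.
by rewrite -pcls_linear !lift_fun_pcls.
Qed.

HB.instance Definition _ x y := GRing.isLinear.Build k
  (@hom k (presented (@E)) x y) (hom (o x) (o y)) *:%R (@lift_fun x y)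
  (@lift_fun_linear x y).

Lemma lift_fun_comp x y z (g : @hom k (presented (@E)) y z) (f : hom x y) :
  lift_fun (compm g f) = compm (lift_fun g) (lift_fun f).
Proof.
have [s ->] := pcls_surj f; have [t ->] := pcls_surj g.
by rewrite pcls_comp !lift_fun_pcls.
Qed.

Definition presented_lift : linfunctor (presented (@E)) D :=
  @LinFunctor k (presented (@E)) D o (fun x y => @lift_fun x y)
    (fun x => lift_fun_pcls (tid x)) lift_fun_comp.

End PresentedLift.

Section IdealLift.
Variables (k : fieldType) (C : lincat k).
Variable S : forall x y : C, hom x y -> Prop.
Arguments S {x y} _.
Let Q := ideal_quotient (@S).

Definition icls x y (f : @hom k C x y) : @hom k Q x y :=
  @cls k (ideal_setoid (@S) x y) f.

Lemma icls_comp x y z (g : @hom k C y z) (f : hom x y) :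
  compm (icls g) (icls f) = icls (compm g f).
Proof. exact: (@qcompE k (ideal_precat (@S))). Qed.

Lemma icls_surj x y (f : @hom k Q x y) : exists g, f = icls g.
Proof. by exists (rep f); rewrite /icls repK. Qed.

Lemma icls_linear x y c (f g : @hom k C x y) :
  icls (c *: f + g) = c *: icls f + icls g.
Proof. by rewrite /icls -clsZ -clsD. Qed.

Lemma icls_eq0 x y (f : @hom k C x y) : icls f = 0 <-> ideal (@S) f.
Proof.
have -> : ideal (@S) f = ieq (@S) f 0 by rewrite /ieq subr0.
exact: (@clsP k (ideal_setoid (@S) x y)).
Qed.

Variables (D : lincat k) (F : linfunctor C D).
Hypothesis FS : forall x y (f : @hom k C x y), S f -> fhom F f = 0.

Lemma fhom_ideal x y (f : @hom k C x y) : ideal (@S) f -> fhom F f = 0.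
Proof.
elim=> {x y f} [x y f /FS //|x y|x y c f g _ Ff _ Fg|x y z g f _ Ff|x y z g f _ Fg].
- exact: linear0.
- by rewrite linearP Ff Fg scaler0 addr0.
- by rewrite fhom_comp Ff compm0.
- by rewrite fhom_comp Fg comp0m.
Qed.

Definition ilift_fun x y (f : @hom k Q x y) : hom (F x) (F y) := fhom F (rep f).

Lemma ilift_fun_icls x y (f : @hom k C x y) : ilift_fun (icls f) = fhom F f.
Proof.
apply: subr0_eq; rewrite -linearB; apply: fhom_ideal.
exact: (rep_cls (f : ideal_setoid (@S) x y)).
Qed.

Lemma ilift_fun_linear x y : linear (@ilift_fun x y).
Proof.
move=> c f g; have [f' ->] := icls_surj f; have [g' ->] := icls_surj g.
by rewrite -icls_linear !ilift_fun_icls linearP.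
Qed.

HB.instance Definition _ x y := GRing.isLinear.Build k
  (@hom k Q x y) (hom (F x) (F y)) *:%R (@ilift_fun x y) (@ilift_fun_linear x y).

Lemma ilift_fun_id x : ilift_fun (@idm k Q x) = idm (F x).
Proof. by rewrite -fhom_id -ilift_fun_icls. Qed.

Lemma ilift_fun_comp x y z (g : @hom k Q y z) (f : hom x y) :
  ilift_fun (compm g f) = compm (ilift_fun g) (ilift_fun f).
Proof.
have [f' ->] := icls_surj f; have [g' ->] := icls_surj g.
by rewrite icls_comp !ilift_fun_icls fhom_comp.
Qed.

Definition ideal_lift : linfunctor Q D :=
  @LinFunctor k Q D F (fun x y => @ilift_fun x y) ilift_fun_id ilift_fun_comp.

End IdealLift.

(** * Normal forms of morphisms on the line *)

Section Paths.
Variables (k : fieldType) (R : realType).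
Local Notation L := (LambdaR k R).
Implicit Types x y z w d e : R.

Definition up x y (xy : x <= y) : @hom k L (Some x) (Some y) :=
  pcls _ (tgen (alpha xy)).
Definition down x y (xy : x <= y) : @hom k L (Some y) (Some x) :=
  pcls _ (tgen (alphas xy)).

Lemma le_or_ge x y : {x <= y} + {y <= x}.
Proof. by case: (leP x y) => [|/ltW]; [left|right]. Qed.

(** One family for both directions: the relations then become symmetric under
    reversal of the line, which turns upward paths into downward ones. *)
Definition dpath x y : @hom k L (Some x) (Some y) :=
  match le_or_ge x y with
  | left xy => up xy
  | right yx => down yx
  end.

Lemma up_id x (xx : x <= x) : up xx = idm (Some x : L).
Proof. by apply: pcls_rel; exact: alpha_id. Qed.

Lemma down_id x (xx : x <= x) : down xx = idm (Some x : L).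
Proof. by apply: pcls_rel; exact: alphas_id. Qed.

Lemma up_down x y (xy : x <= y) (yx : y <= x) : up xy = down yx.
Proof.
have exy : x = y by apply: le_anti; rewrite xy.
by case: y / exy xy yx => xx xx'; rewrite up_id down_id.
Qed.

Lemma dpath_up x y (xy : x <= y) : dpath x y = up xy.
Proof.
rewrite /dpath; case: le_or_ge => [xy'|yx].
  by congr up; exact: bool_irrelevance.
by rewrite up_down.
Qed.

Lemma dpath_down x y (xy : x <= y) : dpath y x = down xy.
Proof.
rewrite /dpath; case: le_or_ge => [yx|xy'].
  exact: up_down.
by congr down; exact: bool_irrelevance.
Qed.

Lemma dpath_id x : dpath x x = idm (Some x : L).
Proof. by rewrite (dpath_up (lexx x)) up_id. Qed.

Lemma dpath_up_comp x y z : x <= y -> y <= z ->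
  compm (dpath y z) (dpath x y) = dpath x z.
Proof.
move=> xy yz; have xz := le_trans xy yz.
rewrite (dpath_up xy) (dpath_up yz) (dpath_up xz) /up pcls_comp.
by apply: pcls_rel; exact: alpha_comp.
Qed.

Lemma dpath_down_comp x y z : y <= x -> z <= y ->
  compm (dpath y z) (dpath x y) = dpath x z.
Proof.
move=> yx zy; have zx := le_trans zy yx.
rewrite (dpath_down yx) (dpath_down zy) (dpath_down zx) /down pcls_comp.
by apply: pcls_rel; exact: alphas_comp.
Qed.

Lemma dpath_updown x y y' z : y' < x -> x < y -> y + y' = x + z ->
  compm (dpath y z) (dpath x y) = compm (dpath y' z) (dpath x y').
Proof.
move=> y'x xy e; pose a := y - x; pose b := x - y'.
have ay : y = x + a by rewrite /a; ring.
have by' : y' = x - b by rewrite /b; ring.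
have abz : z = x + a - b by rewrite /a /b; lra.
have a0 : 0 < a by rewrite subr_gt0.
have b0 : 0 < b by rewrite subr_gt0.
subst z; rewrite ay by'.
have h1 : x <= x + a by lra.
have h2 : x + a - b <= x + a by lra.
have h3 : x - b <= x by lra.
have h4 : x - b <= x + a - b by lra.
rewrite (dpath_up h1) (dpath_down h2) (dpath_down h3) (dpath_up h4).
by rewrite /up /down !pcls_comp; apply: pcls_rel; exact: alpha_alphas.
Qed.

(** When x is an extreme point among the four corners, both sides are the direct
    path from x to z; otherwise this is the defining relation, read in one of its
    two orders. *)
Lemma dpath_square x y y' z : y + y' = x + z ->
  compm (dpath y z) (dpath x y) = compm (dpath y' z) (dpath x y').
Proof.
move=> e; have [yx|xy|exy] := ltgtP y x; have [y'x|xy'|exy'] := ltgtP y' x.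
- by rewrite !dpath_down_comp //; lra.
- by apply/esym/dpath_updown => //; lra.
- have -> : z = y by lra.
  by rewrite exy' !dpath_id compm1 comp1m.
- exact: dpath_updown.
- by rewrite !dpath_up_comp //; lra.
- have -> : z = y by lra.
  by rewrite exy' !dpath_id compm1 comp1m.
- have -> : z = y' by lra.
  by rewrite exy !dpath_id compm1 comp1m.
- have -> : z = y' by lra.
  by rewrite exy !dpath_id compm1 comp1m.
- have -> : z = x by lra.
  by rewrite exy exy'.
Qed.

Definition nf x y d : @hom k L (Some x) (Some y) :=
  compm (dpath (x - d) y) (dpath x (x - d)).

(** The journey [nf x y d] descends by d, then ascends by y - x + d; both amounts
    have to be nonnegative. *)
Definition valid x y d := (0 <= d) && (x - y <= d).

Lemma nf_top x y d : nf x y d = compm (dpath (y + d) y) (dpath x (y + d)).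
Proof. by apply: dpath_square; ring. Qed.

Lemma nf0 x y : nf x y 0 = dpath x y.
Proof. by rewrite /nf subr0 dpath_id compm1. Qed.

Lemma nf_down x y : nf x y (x - y) = dpath x y.
Proof. by rewrite /nf opprB addrC subrK dpath_id comp1m. Qed.

(** The ascent of the first factor, from x - d to y, followed by the descent of
    the second, from y to y - e, is swapped by a square; what remains is a
    descent to x - d - e followed by an ascent to z. *)
Lemma nf_comp x y z d e : valid x y d -> valid y z e ->
  compm (nf y z e) (nf x y d) = nf x z (d + e).
Proof.
move=> /andP[d0 xyd] /andP[e0 yze]; rewrite /nf.
rewrite -!compmA (compmA (dpath y _)) (@dpath_square _ _ (x - d - e)); last by ring.
rewrite -(compmA (dpath (x - d - e) _)) (compmA (dpath (y - e) z)).
rewrite dpath_up_comp; [|lra|lra].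
rewrite dpath_down_comp; [|lra|lra].
by rewrite opprD addrA.
Qed.

(** Morphisms from or to the zero object vanish; including them makes the
    statement stable under composition through any object. *)
Definition nf_spanned (X Y : option R) : @hom k L X Y -> Prop :=
  match X, Y with
  | Some x, Some y => fun f => exists2 l : seq (k * R),
      all (fun i => valid x y i.2) l & f = \sum_(i <- l) i.1 *: nf x y i.2
  | _, _ => fun f => f = 0
  end.

Lemma hom_nf_spanned (X Y : L) (f : hom X Y) : nf_spanned f.
Proof.
have idN : idm (None : L) = 0 by apply: pcls_rel; exact: zero_object.
move: X Y f; apply: presented_ind.
- move=> _ _ [x y xy|x y xy].
    exists [:: (1, 0)]; first by rewrite /= /valid lexx subr_le0 xy.
    by rewrite big_seq1 scale1r nf0 (dpath_up xy).
  exists [:: (1, y - x)]; first by rewrite /= /valid lexx subr_ge0 xy.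
  by rewrite big_seq1 scale1r nf_down (dpath_down xy).
- case=> [x|//]; exists [:: (1, 0)]; first by rewrite /= /valid lexx subrr lexx.
  by rewrite big_seq1 scale1r nf0 dpath_id.
- move=> [x|] [y|] [z|] g f; rewrite /nf_spanned;
    try by move=> -> _; rewrite comp0m.
  + move=> [l lv ->] [m mv ->].
    exists [seq (i.1 * j.1, j.2 + i.2) | i <- l, j <- m].
      apply/allP => _ /allpairsP[[i j] /= [/(allP lv)/andP[i0 yi]
        /(allP mv)/andP[j0 xj] ->]].
      by rewrite /valid /=; apply/andP; split; lra.
    rewrite big_allpairs_dep compm_suml; apply: eq_big_seq => i /(allP lv) vi.
    rewrite compm_sumr; apply: eq_big_seq => j /(allP mv) vj.
    by rewrite compmZl compmZr scalerA nf_comp.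
  + by move=> -> _; exists [::]; rewrite // comp0m big_nil.
  + by move=> _ ->; rewrite compm0.
- by move=> [x|] [y|] //; exists [::]; rewrite ?big_nil.
- move=> [x|] [y|] c f g //; try by move=> -> ->; rewrite scaler0 addr0.
  move=> [l lv ->] [m mv ->]; exists ([seq (c * i.1, i.2) | i <- l] ++ m).
    by rewrite all_cat mv andbT all_map.
  rewrite big_cat big_map scaler_sumr; congr (_ + _).
  by apply: eq_bigr => i _; rewrite scalerA.
Qed.

End Paths.

(** * Coordinates of morphisms *)

Section Coefficients.
Variables (k : fieldType) (R : realType).
Local Notation L := (LambdaR k R).
Implicit Types (x y z w d e t r : R) (X Y Z : option R) (phi : R -> k).

Definition arrow_down X Y (a : arrow X Y) : R :=
  match a with alpha _ _ _ => 0 | alphas x y _ => y - x end.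

(** A representation of the category on functions R -> k, contravariant in the
    order of composition, under which [nf x y d] becomes translation by d. *)
Fixpoint act X Y (s : term k (@arrow R) X Y) (phi : R -> k) (r : R) : k :=
  match s with
  | tgen _ _ a => phi (r + arrow_down a)
  | tid X => if X is Some _ then phi r else 0
  | tcomp _ _ _ g f => act f (act g phi) r
  | tzero _ _ => 0
  | tadd _ _ s t => act s phi r + act t phi r
  | topp _ _ s => - act s phi r
  | tscale _ _ c s => c * act s phi r
  end.

Lemma act_linear X Y (s : term k (@arrow R) X Y) c phi psi r :
  act s (fun r => c * phi r + psi r) r = c * act s phi r + act s psi r.
Proof.
elim: s phi psi r => {X Y} //=.
- by case=> //= *; rewrite mulr0 addr0.
- move=> X Y Z g IHg f IHf phi psi r; rewrite -IHf; congr (act f _ _).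
  by apply/funext => r'; exact: IHg.
- by move=> *; rewrite mulr0 addr0.
- by move=> X Y s IHs t IHt phi psi r; rewrite IHs IHt; ring.
- by move=> X Y s IHs phi psi r; rewrite IHs; ring.
- by move=> X Y a s IHs phi psi r; rewrite IHs; ring.
Qed.

Lemma act0 X Y (s : term k (@arrow R) X Y) r : act s (fun=> 0) r = 0.
Proof.
have := act_linear s (-1) (fun=> 0) (fun=> 0) r.
have -> : (fun _ : R => -1 * 0 + 0 : k) = (fun=> 0) by apply/funext => ?; ring.
by rewrite mulN1r addNr.
Qed.

Lemma act_None X Y (s : term k (@arrow R) X Y) phi r :
  X = None \/ Y = None -> act s phi r = 0.
Proof.
elim: s phi r => {X Y} /=.
- by move=> X Y [x y ?|x y ?] phi r [].
- by move=> X phi r [] ->.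
- move=> X Y Z g IHg f IHf phi r [X0|Z0]; first by apply: IHf; left.
  rewrite (_ : act g phi = fun=> 0) ?act0 //.
  by apply/funext => r'; apply: IHg; right.
- by [].
- by move=> X Y s IHs t IHt phi r XY; rewrite IHs // IHt // addr0.
- by move=> X Y s IHs phi r XY; rewrite IHs // oppr0.
- by move=> X Y a s IHs phi r XY; rewrite IHs // mulr0.
Qed.

Lemma act_teq X Y (s t : term k (@arrow R) X Y) :
  teq (@preproj_rel k R) s t -> act s = act t.
Proof.
suff act_eq : teq (@preproj_rel k R) s t -> forall phi r, act s phi r = act t phi r.
  by move=> st; apply/funext => phi; apply/funext => r; exact: act_eq.
elim=> {X Y s t} /=; try by move=> *; ring.
- move=> X Y s t [|x xx|x xx|x y z xy yz xz|x y z xy yz xz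
    |x a b a0 b0 p1 p2 p3 p4] phi r //=;
    by congr phi; ring.
- by move=> X Y s t _ st phi r; rewrite st.
- by move=> X Y s t u _ st _ tu phi r; rewrite st.
- move=> X Y Z g g' f f' _ gg' _ ff' phi r; rewrite ff'; congr (act f' _ r).
  by apply/funext => r'.
- by move=> X Y s s' t t' _ ss' _ tt' phi r; rewrite ss' tt'.
- by move=> X Y s s' _ ss' phi r; rewrite ss'.
- by move=> X Y c s s' _ ss' phi r; rewrite ss'.
- by move=> X [y|] f phi r //; rewrite [RHS]act_None ?act0 //; right.
- by move=> [x|] Y f phi r //; rewrite [RHS]act_None //; left.
- by move=> X Y Z c g g' f phi r; exact: act_linear.
Qed.

Definition hom_act X Y (f : @hom k L X Y) (phi : R -> k) (r : R) : k :=
  act (rep f) phi r.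

Lemma hom_act_pcls X Y (s : term k (@arrow R) X Y) phi r :
  hom_act (pcls (@preproj_rel k R) s) phi r = act s phi r.
Proof.
congr (_ phi r); apply: act_teq.
exact: (rep_cls (s : term_setoid (@preproj_rel k R) X Y)).
Qed.

Lemma hom_act_comp X Y Z (g : @hom k L Y Z) (f : @hom k L X Y) phi r :
  hom_act (compm g f) phi r = hom_act f (hom_act g phi) r.
Proof.
have [s ->] := pcls_surj f; have [t ->] := pcls_surj g.
rewrite pcls_comp !hom_act_pcls /=; congr (act s _ r).
by apply/funext => r'; rewrite hom_act_pcls.
Qed.

Lemma hom_act_up x y phi r : x <= y -> hom_act (dpath k x y) phi r = phi r.
Proof. by move=> xy; rewrite (dpath_up k xy) hom_act_pcls /= addr0. Qed.

Lemma hom_act_down x y phi r : y <= x ->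
  hom_act (dpath k x y) phi r = phi (r + (x - y)).
Proof. by move=> yx; rewrite (dpath_down k yx) hom_act_pcls. Qed.

Lemma hom_act_nf x y d phi r : valid x y d ->
  hom_act (nf k x y d) phi r = phi (r + d).
Proof.
move=> /andP[d0 xyd]; rewrite /nf hom_act_comp hom_act_down; last lra.
by rewrite hom_act_up ?subKr //; lra.
Qed.

(** Translating the indicator of d and evaluating at 0 detects the journeys with
    descent d. *)
Definition coef d X Y (f : @hom k L X Y) : k :=
  hom_act f (fun r => (r == d)%:R) 0.

Lemma coef_linear d X Y : scalar (@coef d X Y).
Proof.
move=> c f g; have [s ->] := pcls_surj f; have [t ->] := pcls_surj g.
by rewrite -pcls_linear /coef !hom_act_pcls.
Qed.

HB.instance Definition _ d X Y := GRing.isLinear.Build k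
  (@hom k L X Y) k *%R (@coef d X Y) (@coef_linear d X Y).

Lemma coef_nf x y d e : valid x y d -> coef e (nf k x y d) = (d == e)%:R.
Proof. by move=> v; rewrite /coef hom_act_nf // add0r. Qed.

Lemma coef_nf_comp t x y e X (f : @hom k L X (Some x)) : valid x y e ->
  coef t (compm (nf k x y e) f) = coef (t - e) f.
Proof.
move=> v; rewrite /coef hom_act_comp; congr (hom_act f _ 0).
by apply/funext => r; rewrite hom_act_nf // -subr_eq opprK.
Qed.

Lemma hom_nf_coef x y (f : @hom k L (Some x) (Some y)) :
  exists2 s : seq R, all (valid x y) s &
    f = \sum_(d <- s) coef d f *: nf k x y d.
Proof.
have [l lv ->] := hom_nf_spanned f; exists (undup [seq i.2 | i <- l]).
  by apply/allP => d; rewrite mem_undup => /mapP[i /(allP lv) ? ->].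
under [RHS]eq_bigr do rewrite linear_sum scaler_suml.
rewrite exchange_big /=; apply: eq_big_seq => i il.
have vi := allP lv i il.
(* The list may repeat descents; summing over distinct ones collects the
   repetitions, as only d = i.2 sees the i-th term. *)
have i2s : i.2 \in undup [seq i.2 | i <- l] by rewrite mem_undup map_f.
rewrite (bigD1_seq i.2) ?undup_uniq //= big1 => [|d di].
  by rewrite addr0 linearZ /= coef_nf // eqxx mulr1.
by rewrite linearZ /= coef_nf // eq_sym (negPf di) mulr0 scale0r.
Qed.

Lemma coef_comp_neq0 t x y z (g : @hom k L (Some y) (Some z))
    (f : @hom k L (Some x) (Some y)) :
  coef t (compm g f) != 0 -> exists d e,
    [/\ valid x y d, valid y z e, d + e = t, coef d f != 0 & coef e g != 0].
Proof.
have [s sv Ef] := hom_nf_coef f; have [u uv Eg] := hom_nf_coef g.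
apply: contra_neqP => none; rewrite Eg compm_suml linear_sum.
rewrite big_seq big1 // => e eu; rewrite Ef compm_sumr linear_sum.
rewrite big_seq big1 // => d ds; have [vd ve] := (allP sv d ds, allP uv e eu).
rewrite compmZl compmZr nf_comp // !linearZ /= coef_nf; last first.
  by move/andP: vd => [? ?]; move/andP: ve => [? ?]; apply/andP; split; lra.
case: (eqVneq (d + e) t) => [det|_]; last by rewrite !mulr0.
apply/eqP; apply: contra_notT none; rewrite mulr1 mulf_eq0 negb_or.
by move=> /andP[ce cd]; exists d, e.
Qed.

End Coefficients.

(** * Morphisms in the quotient by the complement of an interval *)

Section LambdaHoms.
Variables (k : fieldType) (R : realType) (I : set R).
Local Notation L := (LambdaR k R).
Local Notation LI := (Lambda k I).
Implicit Types x y z w d e t r : R.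

Definition lcls (X Y : L) (f : @hom k L X Y) : @hom k LI X Y :=
  icls (@outside_id k R I) f.

Lemma lcls_eq0 (X Y : L) (f : @hom k L X Y) :
  lcls f = 0 <-> ideal (@outside_id k R I) f.
Proof. exact: icls_eq0. Qed.

(** The journey factors through its lowest stop x - d and, reordered, through its
    highest stop y + d; if either lies outside I, its identity is killed. *)
Lemma ideal_nf x y d : ~ (I (x - d) /\ I (y + d)) ->
  ideal (@outside_id k R I) (nf k x y d).
Proof.
have ideal_id z : ~ I z -> ideal (@outside_id k R I) (idm (Some z : L)).
  by move=> Iz; apply: ideal_gen; constructor.
move/not_andP=> [/ideal_id out|/ideal_id out].
  rewrite /nf -(comp1m (dpath k x (x - d))).
  by apply: ideal_compl; apply: ideal_compr.
rewrite nf_top -(comp1m (dpath k x (y + d))).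
by apply: ideal_compl; apply: ideal_compr.
Qed.

(** By convexity of I, the stops of each factor of a journey lie between the
    extreme stops of the whole; so a surviving journey only has surviving factors,
    which makes the condition stable under composition on either side. *)
Lemma ideal_coef (intI : is_interval I) x y d (f : @hom k L (Some x) (Some y)) :
  ideal (@outside_id k R I) f -> valid x y d -> I (x - d) -> I (y + d) ->
  coef d f = 0.
Proof.
have gen X Y (g : @hom k L X Y) : ideal (@outside_id k R I) g ->
    forall x y, X = Some x -> Y = Some y -> forall d,
    valid x y d -> I (x - d) -> I (y + d) -> coef d g = 0.
  elim=> {X Y x y d f g}.
  - move=> _ _ _ [z Iz] x y [<-] [<-] d vd Ixd Iyd; case: Iz.
    by apply: (intI _ _ Ixd Iyd); move/andP: vd => [? ?]; lra.
  - by move=> X Y *; exact: linear0.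
  - move=> X Y c f g _ IHf _ IHg x y eX eY d vd Ixd Iyd.
    by rewrite linearP /= (IHf x y) // (IHg x y) // addr0 mulr0.
  - move=> X [y|] Z g f _ IHf x z eX eZ t vt Ixt Izt; subst X Z; last first.
      by rewrite (hom_nf_spanned f) compm0 linear0.
    apply/eqP; apply: contraT => /coef_comp_neq0[d [e [vd ve det /eqP]]].
    move: vd ve vt (vd) => /andP[? ?] /andP[? ?] /andP[? ?] vd.
    by case; apply: (IHf x y) => //; apply: (intI _ _ Ixt Izt); lra.
  - move=> X [y|] Z g f _ IHg x z eX eZ t vt Ixt Izt; subst X Z; last first.
      by rewrite (hom_nf_spanned f) compm0 linear0.
    apply/eqP; apply: contraT => /coef_comp_neq0[d [e [vd ve det _ /eqP]]].
    move: vd ve vt (ve) => /andP[? ?] /andP[? ?] /andP[? ?] ve.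
    by case; apply: (IHg y z) => //; apply: (intI _ _ Ixt Izt); lra.
by move=> If; apply: gen If _ _ _ _ _.
Qed.

Lemma coef_ideal x y (f : @hom k L (Some x) (Some y)) :
  (forall d, valid x y d -> I (x - d) -> I (y + d) -> coef d f = 0) ->
  ideal (@outside_id k R I) f.
Proof.
move=> f0; have [s sv Ef] := hom_nf_coef f; rewrite Ef.
elim: s sv {Ef} => [|d s IH] /=; first by rewrite big_nil => _; exact: ideal_zero.
move=> /andP[vd sv]; rewrite big_cons.
have [[Ixd Iyd]|out] := pselect (I (x - d) /\ I (y + d)).
  by rewrite f0 // scale0r add0r; exact: IH.
by apply: ideal_linear; [exact: ideal_nf|exact: IH].
Qed.

Hypothesis intI : is_interval I.

Lemma idm_None : idm (None : LI) = 0.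
Proof.
have idN : idm (None : L) = 0 by apply: pcls_rel; exact: zero_object.
by rewrite -[LHS]/(lcls (idm (None : L))) idN; apply/lcls_eq0; exact: ideal_zero.
Qed.

Lemma idm_Some x : idm (Some x : LI) <> 0 <-> I x.
Proof.
rewrite -[idm _]/(lcls (idm (Some x : L))) -dpath_id -nf0.
have vx : valid x x 0 by rewrite /valid lexx subrr lexx.
split=> [nz|Ix].
  apply: contrapT => out; apply: nz; apply/lcls_eq0/ideal_nf.
  by rewrite subr0 => -[].
move=> /lcls_eq0/(ideal_coef intI)-/(_ _ vx); rewrite subr0 addr0 => /(_ Ix Ix).
by rewrite coef_nf // eqxx => /eqP; rewrite oner_eq0.
Qed.

(** Composition with [nf x y e] shifts coordinates by e, so it loses nothing as
    soon as every surviving journey into x extends to a surviving one into y. *)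
Lemma mono_nf x y e : valid x y e ->
  (forall z d, valid z x d -> I (z - d) -> I (x + d) ->
     I (z - d - e) /\ I (y + d + e)) ->
  mono (lcls (nf k x y e)).
Proof.
move=> vxy stay [z|] H; last by move=> _; exact/hom_from_zero/idm_None.
have [h ->] := icls_surj H => {H}; rewrite icls_comp => /icls_eq0 ph.
apply/icls_eq0/coef_ideal => d vd Izd Ixd.
have [Iz Iy] := stay z d vd Izd Ixd.
rewrite -(addrK e d) -(coef_nf_comp _ _ vxy); apply: ideal_coef => //.
- by move: vd vxy => /andP[? ?] /andP[? ?]; apply/andP; split; lra.
- by rewrite opprD addrA.
- by rewrite addrA.
Qed.

Lemma embeds_nf x y e : I x -> I y -> valid x y e ->
  (forall z d, valid z x d -> I (z - d) -> I (x + d) ->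
     I (z - d - e) /\ I (y + d + e)) ->
  @embeds k LI (Some x) (Some y).
Proof.
move=> Ix Iy v stay; split; [exact/idm_Some|exact/idm_Some|].
by exists (lcls (nf k x y e)); exact: mono_nf.
Qed.

Lemma embeds_down x y : (forall a b, a <= b -> I b -> I a) ->
  I x -> I y -> y <= x -> @embeds k LI (Some x) (Some y).
Proof.
move=> downI Ix Iy yx; apply: (@embeds_nf _ _ (x - y)) => // [|z d _ Izd Ixd].
  by rewrite /valid lexx subr_ge0 yx.
split; first by apply: downI Izd; lra.
by have -> : y + d + (x - y) = x + d by ring.
Qed.

Lemma embeds_up x y : (forall a b, a <= b -> I a -> I b) ->
  I x -> I y -> x <= y -> @embeds k LI (Some x) (Some y).
Proof.
move=> upI Ix Iy xy; apply: (@embeds_nf _ _ 0) => // [|z d _ Izd Ixd].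
  by rewrite /valid lexx subr_le0 xy.
by rewrite subr0 addr0; split=> //; apply: upI Ixd; lra.
Qed.

(** The test morphism is the surviving journey [nf w x e]; the hypothesis says
    that every journey from x to y carries it out of I. *)
Lemma not_mono w x y e (f : @hom k LI (Some x) (Some y)) : valid w x e ->
  I (w - e) -> I (x + e) ->
  (forall d, valid x y d -> ~ (I (w - (e + d)) /\ I (y + (e + d)))) ->
  ~ mono f.
Proof.
move=> v Iwe Ixe out mf.
have /mf : compm f (lcls (nf k w x e)) = 0.
  have [g ->] := icls_surj f; have [s sv Eg] := hom_nf_coef g.
  rewrite icls_comp; apply/icls_eq0; rewrite Eg compm_suml big_seq.
  elim/big_ind: _ => [|a b|d ds]; [exact: ideal_zero|exact: idealD|].
  have vd := allP sv d ds.
  by rewrite compmZl nf_comp //; apply/idealZ/ideal_nf/out.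
move=> /lcls_eq0/(ideal_coef intI)-/(_ _ v Iwe Ixe).
by rewrite coef_nf // eqxx => /eqP; rewrite oner_eq0.
Qed.

(** Descend to x from a point w so close to b that climbing by y - x from w leaves
    I. *)
Lemma not_embeds_up b x y : (forall z, I z -> z < b) ->
  (forall z, x <= z -> z < b -> I z) -> x < y -> ~ @embeds k LI (Some x) (Some y).
Proof.
move=> Ib bI xy [/idm_Some Ix /idm_Some Iy [f]].
(* The maximum is needed when x is closer to b than y - x: then w = x. *)
pose w := Num.max x (b - (y - x)).
have xw : x <= w by rewrite le_max lexx.
have wb : w < b by rewrite gt_max Ib //=; lra.
have bw : b - (y - x) <= w by rewrite le_max lexx orbT.
apply: (@not_mono w _ _ (w - x)).
- by rewrite /valid lexx subr_ge0 xw.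
- by rewrite subKr.
- by rewrite subrKC; exact: bI.
- by move=> d /andP[? ?] [_ /Ib]; lra.
Qed.

Lemma not_embeds_down a x y : (forall z, I z -> a < z) ->
  (forall z, z <= x -> a < z -> I z) -> y < x -> ~ @embeds k LI (Some x) (Some y).
Proof.
move=> Ia aI yx [/idm_Some Ix /idm_Some Iy [f]].
pose w := Num.min x (a + (x - y)).
have wx : w <= x by rewrite ge_min lexx.
have aw : a < w by rewrite lt_min Ia //=; lra.
have wa : w <= a + (x - y) by rewrite ge_min lexx orbT.
apply: (@not_mono w _ _ 0).
- by rewrite /valid lexx subr_le0 wx.
- by rewrite subr0; exact: aI.
- by rewrite addr0.
- by move=> d /andP[? ?] [/Ia]; lra.
Qed.

End LambdaHoms.

(** * Equivalences induced by affine maps *)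

Section AffineFunctor.
Variables (k : fieldType) (R : realType) (I J : set R) (m c : R).
Hypothesis m_neq0 : m != 0.
Local Notation L := (LambdaR k R).
Implicit Types x y z : R.

Let s x := m * x + c.
Hypothesis JI : forall x, J (s x) -> I x.

Definition lpath (K : set R) x y : @hom k (Lambda k K) (Some x) (Some y) :=
  lcls K (dpath k x y).

Lemma lpath_id (K : set R) x : lpath K x x = idm (Some x : Lambda k K).
Proof. by rewrite /lpath dpath_id. Qed.

Lemma lpath_comp (K : set R) x y z : (x <= y <= z) || (z <= y <= x) ->
  compm (lpath K y z) (lpath K x y) = lpath K x z.
Proof.
rewrite icls_comp => /orP[] /andP[h1 h2]; congr icls.
  exact: dpath_up_comp.
exact: dpath_down_comp.
Qed.

Lemma lpath_square (K : set R) x y y' z : y + y' = x + z ->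
  compm (lpath K y z) (lpath K x y) = compm (lpath K y' z) (lpath K x y').
Proof. by move=> e; rewrite !icls_comp (dpath_square k e). Qed.

(** For m < 0 upward arrows go to downward ones; direct paths cover both signs. *)
Definition affine_arrow (X Y : option R) (a : arrow X Y) :
    @hom k (Lambda k J) (omap s X) (omap s Y) :=
  match a with
  | alpha x y _ => lpath J (s x) (s y)
  | alphas x y _ => lpath J (s y) (s x)
  end.

Lemma affine_between x y z : x <= y -> y <= z ->
  (s x <= s y <= s z) || (s z <= s y <= s x).
Proof.
move=> xy yz; case: (ltgtP m 0) m_neq0 => // m0 _; rewrite /s !lerD2r.
  by rewrite !(ler_nM2l m0) xy yz orbT.
by rewrite !(ler_pM2l m0) xy yz.
Qed.

Lemma affine_arrow_rel (X Y : option R) (t u : term k (@arrow R) X Y) :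
  preproj_rel t u -> eval affine_arrow t = eval affine_arrow u.
Proof.
case=> {X Y t u} /=.
- exact: idm_None.
- by move=> x _; exact: lpath_id.
- by move=> x _; exact: lpath_id.
- by move=> x y z xy yz _; apply/lpath_comp/affine_between.
- by move=> x y z xy yz _; apply: lpath_comp; rewrite orbC affine_between.
- by move=> x a b _ _ _ _ _ _; apply: lpath_square; rewrite /s; ring.
Qed.

Definition affine_lift : linfunctor L (Lambda k J) :=
  presented_lift affine_arrow_rel.

Lemma affine_lift_outside (X Y : L) (f : @hom k L X Y) :
  outside_id I f -> fhom affine_lift f = 0.
Proof.
case=> x Ix; rewrite fhom_id -[LHS]/(lcls J (idm (Some (s x) : L))).
apply/lcls_eq0/ideal_gen; constructor; by move/JI.
Qed.

Definition affine_functor : linfunctor (Lambda k I) (Lambda k J) :=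
  ideal_lift affine_lift_outside.

Lemma affine_functor_path x y :
  fhom affine_functor (lpath I x y) = lpath J (s x) (s y).
Proof.
rewrite /= (ilift_fun_icls affine_lift_outside) /=.
have [xy|yx] := le_or_ge x y.
  by rewrite (dpath_up k xy) (lift_fun_pcls affine_arrow_rel).
by rewrite (dpath_down k yx) (lift_fun_pcls affine_arrow_rel).
Qed.

End AffineFunctor.

Section AffineEquivalence.
Variables (k : fieldType) (R : realType).

(** The composite of the object maps is the identity only propositionally, so the
    natural isomorphism consists of direct paths between equal points. *)
Lemma affine_natiso (I J : set R) (m c m' c' : R) (m0 : m != 0) (m'0 : m' != 0)
    (JI : forall x, J (m * x + c) -> I x)
    (IJ : forall x, I (m' * x + c') -> J x) :
  (forall x, m' * (m * x + c) + c' = x) ->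
  natiso_to_id (affine_functor k m0 JI) (affine_functor k m'0 IJ).
Proof.
set F := affine_functor k m0 JI; set G := affine_functor k m'0 IJ => sK.
pose u (X : Lambda k I) : hom (G (F X)) X :=
  match X return @hom k (Lambda k I) (G (F X)) X with
  | Some x => lpath k I (m' * (m * x + c) + c') x
  | None => idm (None : Lambda k I)
  end.
pose v (X : Lambda k I) : hom X (G (F X)) :=
  match X return @hom k (Lambda k I) X (G (F X)) with
  | Some x => lpath k I x (m' * (m * x + c) + c')
  | None => idm (None : Lambda k I)
  end.
have nat_path x y : compm (u (Some y)) (fhom G (fhom F (lpath k I x y))) =
    compm (lpath k I x y) (u (Some x)).
  by rewrite !affine_functor_path; apply: lpath_square; rewrite !sK addrC.
have iso x y : x = y ->
    compm (lpath k I y x) (lpath k I x y) = idm (Some x : Lambda k I).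
  by move->; rewrite lpath_id comp1m.
exists u, v; split=> [[x|]|X Y f].
- by split; apply: iso; rewrite sK.
- by rewrite comp1m.
have [g ->] := icls_surj f => {f}; move: X Y g; apply: presented_ind.
- move=> _ _ [x y xy|x y xy].
    by have := nat_path x y; rewrite /lpath (dpath_up k xy).
  by have := nat_path y x; rewrite /lpath (dpath_down k xy).
- move=> X; rewrite -[icls _ _]/(idm (X : Lambda k I)).
  by rewrite !fhom_id comp1m compm1.
- move=> X Y Z g f IHg IHf.
  by rewrite -icls_comp !fhom_comp compmA IHg -!compmA IHf.
- move=> X Y; have -> : icls (@outside_id k R I) (0 : @hom k (LambdaR k R) X Y) = 0.
    by apply/icls_eq0; exact: ideal_zero.
  by rewrite !linear0 compm0 comp0m.
- move=> X Y a f g IHf IHg; rewrite icls_linear !linearP.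
  by rewrite compm_linear_r compm_linear_l IHf IHg.
Qed.

Lemma affine_equivalent (I J : set R) (m c : R) : m != 0 ->
  (forall x, I x <-> J (m * x + c)) -> lin_equivalent (Lambda k I) (Lambda k J).
Proof.
move=> m0 IJ; have m'0 : m^-1 != 0 by rewrite invr_eq0.
have sK x : m * (m^-1 * x + - m^-1 * c) + c = x by field.
have JI' x : I (m^-1 * x + - m^-1 * c) -> J x by move/IJ; rewrite sK.
exists (affine_functor k m0 (fun x => (IJ x).2)), (affine_functor k m'0 JI').
by split; apply: affine_natiso => // x; field.
Qed.

End AffineEquivalence.

(** * Types of open intervals *)

Section Classification.
Variables (R : realType).
Implicit Types (I J : set R) (t : interval_type).

Lemma lbound_open_itv (a : R) (b : itv_bound R) :
  has_lbound [set` Interval (BRight a) b].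
Proof. by exists a => x; rewrite /= in_itv /= => /andP[/ltW]. Qed.

Lemma ubound_open_itv (a : itv_bound R) (b : R) :
  has_ubound [set` Interval a (BLeft b)].
Proof. by exists b => x; rewrite /= in_itv /= => /andP[_ /ltW]. Qed.

Lemma left_ray_nlbound (b : R) : ~ has_lbound [set` `]-oo, b[].
Proof.
move=> [M lbM]; pose w := Num.min M b - 1.
have wb : w < b by rewrite ltrBlDr gt_min ltrDl ltr01 orbT.
have wM : w < M by rewrite ltrBlDr gt_min ltrDl ltr01.
by have := lbM w; rewrite /= in_itv /= leNgt wM => /(_ wb).
Qed.

Lemma right_ray_nubound (a : R) : ~ has_ubound [set` `]a, +oo[].
Proof.
move=> [M ubM]; pose w := Num.max M a + 1.
have aw : a < w by rewrite ltr_pwDr // le_max lexx orbT.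
have Mw : M < w by rewrite ltr_pwDr // le_max lexx.
by have := ubM w; rewrite /= in_itv /= andbT leNgt Mw => /(_ aw).
Qed.

(** The type only records which ends are bounded: an open interval equals its
    interior, so a finite end is its infimum or supremum and is not attained. *)
Lemma has_typeP I t : nonempty_open_interval I -> has_type I t <->
  match t with
  | BothSides => has_lbound I /\ has_ubound I
  | OneSide => ~ (has_lbound I <-> has_ubound I)
  | NoSide => ~ has_lbound I /\ ~ has_ubound I
  end.
Proof.
move=> [[x0 Ix0] openI intI]; have /interior_id intE := openI.
case: t => /=; split.
- by move=> [a [b [_ ->]]]; split; [exact: lbound_open_itv|exact: ubound_open_itv].
- move=> [lI uI]; exists (inf I), (sup I).
  have EI : I = [set` `]inf I, sup I[].
    by rewrite -{1}intE interval_bounded_interior.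
  have : [set` `]inf I, sup I[] x0 by rewrite -EI.
  by rewrite /= in_itv /= => /andP[h1 h2]; split=> //; exact: lt_trans h1 h2.
- move=> [[b ->] [_]|[a ->] [+ _]].
    by move=> /(_ (ubound_open_itv _ _)); exact: left_ray_nlbound.
  by move=> /(_ (lbound_open_itv _ _)); exact: right_ray_nubound.
- move=> NI; have [lI|nlI] := pselect (has_lbound I).
    have nuI : ~ has_ubound I by move=> uI; apply: NI.
    right; exists (inf I); rewrite -{1}intE interval_right_unbounded_interior //.
    by apply/seteqP; split=> x; rewrite /= in_itv /= andbT.
  have uI : has_ubound I by apply: contrapT => nuI; apply: NI.
  left; exists (sup I); by rewrite -{1}intE interval_left_unbounded_interior.
- move=> ->; split=> -[M hM].
    by have := hM (M - 1) Logic.I; rewrite leNgt ltrBlDr ltrDl ltr01.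
  by have := hM (M + 1) Logic.I; rewrite leNgt ltrDl ltr01.
- by move=> [nlI nuI]; exact: interval_unbounded_setT.
Qed.

Lemma interval_type_unique I : nonempty_open_interval I ->
  exists! t, has_type I t.
Proof.
move=> noI.
have uniq t t' : has_type I t -> has_type I t' -> t = t'.
  move=> /(has_typeP _ noI) + /(has_typeP _ noI).
  by case: t; case: t' => //=; tauto.
suff [t It] : exists t, has_type I t by exists t; split=> // t'; exact: uniq.
have [lI|nlI] := pselect (has_lbound I); have [uI|nuI] := pselect (has_ubound I).
- by exists BothSides; apply/has_typeP.
- by exists OneSide; apply/has_typeP => //; tauto.
- by exists OneSide; apply/has_typeP => //; tauto.
- by exists NoSide; apply/has_typeP.
Qed.

Lemma interval_type_inhabited t :
  exists I : set R, nonempty_open_interval I /\ has_type I t.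
Proof.
have noi (i : interval R) : [set` i] !=set0 -> open [set` i] ->
    nonempty_open_interval [set` i].
  by move=> i0 oi; split=> //; exact: interval_is_interval.
case: t.
- exists [set` `]0, 1[]; split; last by exists 0, 1.
  apply: noi; last exact: interval_open.
  by exists 2^-1; rewrite /= in_itv /=; lra.
- exists [set` `]-oo, 0[]; split; last by left; exists 0.
  apply: noi; last exact: interval_open.
  by exists (-1); rewrite /= in_itv /=; lra.
- exists setT; split=> //; split=> //; [by exists 0|exact: openT].
Qed.

Variable k : fieldType.

(** * Classification *)

Lemma Lambda_of_type I J t : has_type I t -> has_type J t ->
  lin_equivalent (Lambda k I) (Lambda k J).
Proof.
case: t => /=.
- move=> [a [b [ab ->]]] [c [d [cd ->]]].
  pose m := (d - c) / (b - a).
  have ba0 : 0 < b - a by rewrite subr_gt0.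
  have m0 : 0 < m by rewrite divr_gt0 // subr_gt0.
  apply: (@affine_equivalent _ _ _ _ m (c - m * a)); first by rewrite gt_eqF.
  move=> x; rewrite /= !in_itv /=.
  have -> : (c < m * x + (c - m * a)) = (a < x).
    by rewrite addrCA -mulrBr ltrDl pmulr_rgt0 // subr_gt0.
  suff -> : (m * x + (c - m * a) < d) = (x < b) by [].
  have -> : d = m * b + (c - m * a) by rewrite /m; field; lra.
  by rewrite ltrD2r ltr_pM2l.
- move=> [[b ->]|[a ->]] [[d ->]|[c ->]].
  + apply: (@affine_equivalent _ _ _ _ 1 (d - b)); first exact: oner_neq0.
    by move=> x; rewrite /= !in_itv /=; split; lra.
  + apply: (@affine_equivalent _ _ _ _ (-1) (c + b)); first by rewrite oppr_eq0 oner_eq0.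
    by move=> x; rewrite /= !in_itv /= andbT; split; lra.
  + apply: (@affine_equivalent _ _ _ _ (-1) (a + d)); first by rewrite oppr_eq0 oner_eq0.
    by move=> x; rewrite /= !in_itv /= andbT; split; lra.
  + apply: (@affine_equivalent _ _ _ _ 1 (c - a)); first exact: oner_neq0.
    by move=> x; rewrite /= !in_itv /= !andbT; split; lra.
- move=> -> ->; apply: (@affine_equivalent _ _ _ _ 1 0); first exact: oner_neq0.
  by [].
Qed.

Lemma nonzero_Lambda I (X : Lambda k I) : is_interval I -> idm X <> 0 ->
  exists2 x, X = Some x & I x.
Proof.
case: X => [x|] intI nz; last by case: nz; exact: idm_None.
by exists x => //; exact: (idm_Some k intI x).1.
Qed.

Lemma type_interval I t : has_type I t -> is_interval I.
Proof.
case: t => /= [[a [b [_ ->]]]|[[b ->]|[a ->]]|->] //; exact: interval_is_interval.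
Qed.

Lemma BothSides_embeds I : has_type I BothSides ->
  embeds_sym (Lambda k I) /\ ~ embeds_full (Lambda k I).
Proof.
move=> tI; have intI := type_interval tI; case: tI => a [b [ab EI]].
have IE x : I x <-> a < x /\ x < b.
  by rewrite EI /= in_itv /=; split=> [/andP|[-> ->]].
have discr x y : @embeds k (Lambda k I) (Some x) (Some y) -> x = y.
  move=> xy; have Ix : I x by case: xy => nx _ _; exact: (idm_Some k intI x).1.
  case: (ltgtP x y) => // [h|h]; exfalso; move: xy.
    apply: (@not_embeds_up _ _ _ intI b) => // [z /IE[]//|z xz zb].
    by apply/IE; split=> //; apply: lt_le_trans xz; case/IE: Ix.
  apply: (@not_embeds_down _ _ _ intI a) => // [z /IE[]//|z xz zb].
  by apply/IE; split=> //; apply: le_lt_trans xz _; case/IE: Ix.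
split=> [X Y XY|full].
  have [/(nonzero_Lambda intI)[x Ex _] /(nonzero_Lambda intI)[y Ey _] _] := XY.
  by subst X Y; have exy := discr _ _ XY; move: XY; rewrite exy.
pose x := (2 * a + b) / 3; pose y := (a + 2 * b) / 3.
have Ix : I x by apply/IE; rewrite /x; split; lra.
have Iy : I y by apply/IE; rewrite /y; split; lra.
have : x = y by apply/discr/full; exact/idm_Some.
by rewrite /x /y; lra.
Qed.

Lemma OneSide_embeds I : has_type I OneSide -> ~ embeds_sym (Lambda k I).
Proof.
move=> tI; have intI := type_interval tI => symI.
case: tI => -[b EI].
  have IE x : I x <-> x < b by rewrite EI /= in_itv /=.
  have I1 : I (b - 1) by apply/IE; lra.
  have I2 : I (b - 2) by apply/IE; lra.
  have : @embeds k (Lambda k I) (Some (b - 1)) (Some (b - 2)).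
    apply: embeds_down => //; last by lra.
    by move=> x y xy /IE yb; apply/IE; exact: le_lt_trans yb.
  move/symI; apply: (@not_embeds_up _ _ _ intI b); last by lra.
    by move=> z /IE.
  by move=> z _ /IE.
have IE x : I x <-> b < x by rewrite EI /= in_itv /= andbT.
have I1 : I (b + 1) by apply/IE; lra.
have I2 : I (b + 2) by apply/IE; lra.
have : @embeds k (Lambda k I) (Some (b + 1)) (Some (b + 2)).
  apply: embeds_up => //; last by lra.
  by move=> x y xy /IE bx; apply/IE; exact: lt_le_trans xy.
move/symI; apply: (@not_embeds_down _ _ _ intI b); last by lra.
  by move=> z /IE.
by move=> z _ /IE.
Qed.

Lemma NoSide_embeds I : has_type I NoSide ->
  embeds_sym (Lambda k I) /\ embeds_full (Lambda k I).
Proof.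
move=> tI; have intI := type_interval tI; move: tI intI => /= -> intI.
suff full : embeds_full (Lambda k [set: R]).
  by split=> // X Y [X0 Y0 _]; exact: full.
move=> X Y /(nonzero_Lambda intI)[x -> _] /(nonzero_Lambda intI)[y -> _].
by have [xy|yx] := le_or_ge x y; [exact: embeds_up|exact: embeds_down].
Qed.

Lemma equivalent_same_type I J t t' : has_type I t -> has_type J t' ->
  lin_equivalent (Lambda k I) (Lambda k J) -> t = t'.
Proof.
move=> It Jt IJ; have JI := equivalent_sym IJ.
have sIJ := equivalent_embeds_sym IJ; have sJI := equivalent_embeds_sym JI.
have fIJ := equivalent_embeds_full IJ; have fJI := equivalent_embeds_full JI.
by case: t t' It Jt => -[] //
  => [/BothSides_embeds ? /OneSide_embeds ?|/BothSides_embeds ? /NoSide_embeds ?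
     |/OneSide_embeds ? /BothSides_embeds ?|/OneSide_embeds ? /NoSide_embeds ?
     |/NoSide_embeds ? /BothSides_embeds ?|/NoSide_embeds ? /OneSide_embeds ?]; tauto.
Qed.

End Classification.

Theorem proposition3p2 (k : closedFieldType) (R : realType) :
  (forall I : set R, nonempty_open_interval I ->
     exists! t : interval_type, has_type I t) /\
  (forall t : interval_type,
     exists I : set R, nonempty_open_interval I /\ has_type I t) /\
  (forall I J : set R, nonempty_open_interval I -> nonempty_open_interval J ->
     (lin_equivalent (Lambda k I) (Lambda k J) <->
      exists t : interval_type, has_type I t /\ has_type J t)).
Proof.
split; first exact: interval_type_unique.
split; first exact: interval_type_inhabited.
move=> I J /interval_type_unique[t [It _]] /interval_type_unique[t' [Jt' _]].
split=> [IJ|[s [Is Js]]]; last exact: Lambda_of_type Is Js.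
by exists t; split=> //; rewrite (equivalent_same_type It Jt' IJ).
Qed.
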